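(* In the setting of the context, consider the two families of linear inequalities $$x_t-x_{t-k}\le(\underline C+(k-m)V)y_t+V\sum_{i=1}^m y_{t+i}-\underline C y_{t-k}-\sum_{s\in\mathcal S}(\underline C+(k-s)V-\overline V)(y_{t-s}-y_{t-s-1}),$$ indexed by all $k\in[1,T-1]_{\mathbb Z}$ with $\overline C-\underline C-kV>0$, $m\in[0,k-1]_{\mathbb Z}$, $\mathcal S\subseteq[0,\min\{k-1,L-m-1\}]_{\mathbb Z}$ and $t\in[k+1,T-m]_{\mathbb Z}$, and $$x_t-x_{t+k}\le(\underline C+(k-m)V)y_t+V\sum_{i=1}^m y_{t-i}-\underline C y_{t+k}-\sum_{s\in\mathcal S}(\underline C+(k-s)V-\overline V)(y_{t+s}-y_{t+s+1}),$$ indexed by the same $k,m,\mathcal S$ and $t\in[m+1,T-k]_{\mathbb Z}$. For any given point $(\mathbf x,\mathbf y)\in\mathbb R_+^{2T}$, a most violated inequality of each family can be determined in $O(T^3)$ time if a violated inequality of that family exists.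
   Context: For integers $a,b$, $[a,b]_{\mathbb Z}=\{a,a+1,\dots,b\}$ if $a\le b$ and $\emptyset$ otherwise. Fix a positive integer $T$, a positive integer $L$ (minimum up time), and reals $\overline C,\underline C,V,\overline V$ with $\overline C>\underline C>0$, $V>0$, $\overline V+V\le\overline C$ and $\underline C<\overline V<\underline C+V$; $\mathbf x=(x_1,\dots,x_T)$, $\mathbf y=(y_1,\dots,y_T)$. For an inequality $a^\top(\mathbf x,\mathbf y)\le b$, its violation at a given point is $a^\top(\mathbf x,\mathbf y)-b$; it is violated if this is positive, and a most violated inequality of a family is one maximizing this quantity over the family. Time is measured in arithmetic operations and comparisons on the input numbers. *)

(* Defs.v *)
From HB Require Import structures.
From mathcomp Require Import all_boot all_order all_algebra.
Set Implicit Arguments. Unset Strict Implicit. Unset Printing Implicit Defensive.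
Import Order.TTheory GRing.Theory Num.Theory.
Local Open Scope ring_scope.

(* An index is (k, m, Ss, t); the subset S is given by a duplicate-free  *)
(* sequence of naturals.                                                *)
Definition ineq_index := (nat * nat * seq nat * nat)%type.


(* k in [1,T-1], Cbar - Cund - kV > 0, m in [0,k-1],
   S subset of [0, min(k-1, L-m-1)] (integer interval, empty if L-m-1<0),
   plus the family-specific range for t. *)
Definition valid_kmS (R : realFieldType) (T L : nat) (Cbar Cund V Vbar : R) (k m : nat) (Ss : seq nat) : bool :=
  [&& (1 <= k)%N, (k <= T - 1)%N, 0 < Cbar - Cund - k%:R * V, (m <= k - 1)%N,
      uniq Ss & all (fun s => (s <= k - 1)%N && (s + m + 1 <= L)%N) Ss].

Definition valid1 (R : realFieldType) (T L : nat) (Cbar Cund V Vbar : R) (i : ineq_index) : bool :=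
  let: (k, m, Ss, t) := i in valid_kmS T L Cbar Cund V Vbar k m Ss && (k + 1 <= t <= T - m)%N.

Definition valid2 (R : realFieldType) (T L : nat) (Cbar Cund V Vbar : R) (i : ineq_index) : bool :=
  let: (k, m, Ss, t) := i in valid_kmS T L Cbar Cund V Vbar k m Ss && (m + 1 <= t <= T - k)%N.

Definition viol1 (R : realFieldType) (Cund V Vbar : R) (x y : nat -> R) (i : ineq_index) : R :=
  let: (k, m, Ss, t) := i in
  (x t - x (t - k)%N) -
  ((Cund + (k%:R - m%:R) * V) * y t + V * (\sum_(1 <= j < m.+1) y (t + j)%N)
   - Cund * y (t - k)%N
   - \sum_(s <- Ss) (Cund + (k%:R - s%:R) * V - Vbar) *
                     (y (t - s)%N - y (t - s - 1)%N)).

Definition viol2 (R : realFieldType) (Cund V Vbar : R) (x y : nat -> R) (i : ineq_index) : R :=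
  let: (k, m, Ss, t) := i in
  (x t - x (t + k)%N) -
  ((Cund + (k%:R - m%:R) * V) * y t + V * (\sum_(1 <= j < m.+1) y (t - j)%N)
   - Cund * y (t + k)%N
   - \sum_(s <- Ss) (Cund + (k%:R - s%:R) * V - Vbar) *
                     (y (t + s)%N - y (t + s + 1)%N)).

(* Model of computation: algorithms may manipulate the input numbers  *)
(* only through abstract operations (arithmetic and comparisons), in   *)
(* an abstract monad.  Each such operation costs one unit; control    *)
(* flow on indices (naturals) is free.                                 *)
Record Ops (M : Type -> Type) (N : Type) := {
  op_ret  : forall A : Type, A -> M A;
  op_bind : forall A B : Type, M A -> (A -> M B) -> M B;
  op_add  : N -> N -> M N;
  op_sub  : N -> N -> M N;
  op_mul  : N -> N -> M N;
  op_div  : N -> N -> M N;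
  op_nat  : nat -> M N;
  op_le   : N -> N -> M bool;
  op_lt   : N -> N -> M bool
}.

Definition algorithm : Type :=
  forall (M : Type -> Type) (N : Type), Ops M N ->
    nat -> nat -> N -> N -> N -> N -> (nat -> N) -> (nat -> N) ->
    M (option ineq_index).

Definition CM (A : Type) : Type := (A * nat)%type.

Definition count_ops (R : realFieldType) : Ops CM R := {|
  op_ret  := fun A a => (a, 0%N);
  op_bind := fun A B m f => let: (a, c) := m in let: (b, c') := f a in (b, (c + c')%N);
  op_add  := fun a b => (a + b, 1%N);
  op_sub  := fun a b => (a - b, 1%N);
  op_mul  := fun a b => (a * b, 1%N);
  op_div  := fun a b => (a / b, 1%N);
  op_nat  := fun n => (n%:R, 1%N);
  op_le   := fun a b => (a <= b, 1%N);
  op_lt   := fun a b => (a < b, 1%N)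
|}.

Definition run (R : realFieldType) (alg : algorithm) (T L : nat)
  (Cbar Cund V Vbar : R) (x y : nat -> R) : option ineq_index * nat :=
  alg CM R (count_ops R) T L Cbar Cund V Vbar x y.

Definition params_ok (R : realFieldType) (T L : nat) (Cbar Cund V Vbar : R) : Prop :=
  [/\ (0 < T)%N, (0 < L)%N, Cund < Cbar, 0 < Cund & 0 < V] /\
  [/\ Vbar + V <= Cbar, Cund < Vbar & Vbar < Cund + V].

Definition separates_in_cubic_time (alg : algorithm)
  (valid : forall R : realFieldType, nat -> nat -> R -> R -> R -> R -> ineq_index -> bool)
  (viol : forall R : realFieldType, R -> R -> R -> (nat -> R) -> (nat -> R) -> ineq_index -> R)
  : Prop :=
  exists c : nat,
  forall (R : realFieldType) (T L : nat) (Cbar Cund V Vbar : R) (x y : nat -> R),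
    params_ok T L Cbar Cund V Vbar ->
    (forall i, (1 <= i <= T)%N -> 0 <= x i /\ 0 <= y i) ->
    let res := run alg T L Cbar Cund V Vbar x y in
    (res.2 <= c * T ^ 3)%N /\
    ((exists j, valid R T L Cbar Cund V Vbar j &&
                (0 < viol R Cund V Vbar x y j)) ->
     exists i, res.1 = Some i /\ valid R T L Cbar Cund V Vbar i /\
       forall j, valid R T L Cbar Cund V Vbar j ->
         viol R Cund V Vbar x y j <= viol R Cund V Vbar x y i).

(* Main.v *)
Require Import Defs.
From HB Require Import structures.
From mathcomp Require Import all_boot all_order all_algebra.
From mathcomp Require Import zify lra.
Set Implicit Arguments. Unset Strict Implicit. Unset Printing Implicit Defensive.
Import Order.TTheory GRing.Theory Num.Theory.
Local Open Scope ring_scope.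

(* For fixed (k, m, t) the violation is a constant plus the sum over s in S of
   g_s = (Cund + (k - s) V - Vbar) (y_{t-s} - y_{t-s-1}), and S ranges over the
   subsets of [0, min(k, L - m)); so the most violated choice of S keeps exactly
   the s with g_s > 0.  Prefix sums in j (for the sum of the y_{t+j}) and in s
   (for the positive g_s) are computed with O(T) operations per pair (t, k); after
   that each of the O(T^3) triples (t, k, m) costs O(1), and a linear scan for the
   maximum returns a most violated inequality.  Reversing time, t |-> T + 1 - t,
   maps the second family onto the first one for the reversed data. *)

Lemma sumn_map_le (A : eqType) (f : A -> nat) l c :
  {in l, forall a, f a <= c}%N -> (sumn (map f l) <= size l * c)%N.
Proof.
elim: l => //= a l IH fc; rewrite mulSn leq_add ?fc ?mem_head //.
by apply: IH => b lb; rewrite fc // in_cons lb orbT.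
Qed.

Lemma size_filter_iota a b (p : pred nat) : (size [seq i <- iota a b | p i] <= b)%N.
Proof. by rewrite size_filter -[leqRHS](size_iota a) count_size. Qed.

Lemma sum_subset_le_sum_pos (R : realDomainType) (I : eqType) (f : I -> R) (r s : seq I) :
  uniq r -> uniq s -> {subset s <= r} ->
  \sum_(i <- s) f i <= \sum_(i <- r | 0 < f i) f i.
Proof.
move=> r_uniq s_uniq sr.
have s_perm : perm_eq s [seq i <- r | i \in s].
  apply: uniq_perm => //; first exact: filter_uniq.
  by move=> i; rewrite mem_filter andb_idr //; apply: sr.
rewrite (perm_big _ s_perm) big_filter [leLHS]big_mkcond [leRHS]big_mkcond /=.
by apply: ler_sum => i _; case: (i \in s); case: ltP => //= /ltW.
Qed.

Section Algorithm.
Variables (M : Type -> Type) (N : Type) (O : Ops M N).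
Local Notation "'let*' x := m 'in' e" := (op_bind O m (fun x => e))
  (at level 200, x name, m at level 100, e at level 200).

Fixpoint mapM A B (f : A -> M B) (l : seq A) : M (seq B) :=
  match l with
  | [::] => op_ret O [::]
  | a :: l' => let* b := f a in let* r := mapM f l' in op_ret O (b :: r)
  end.

Definition filterM A (p : A -> M bool) (l : seq A) : M (seq A) :=
  let* bs := mapM p l in op_ret O [seq ab.1 | ab <- zip l bs & ab.2].

Fixpoint psumsM (acc : N) (l : seq N) : M (seq N) :=
  match l with
  | [::] => op_ret O [:: acc]
  | a :: l' =>
    let* acc' := op_add O acc a in let* r := psumsM acc' l' in op_ret O (acc :: r)
  end.

Fixpoint argmaxM I (best : I * N) (l : seq (I * N)) : M (I * N) :=
  match l with
  | [::] => op_ret O best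
  | c :: l' => let* better := op_lt O best.2 c.2 in argmaxM (if better then c else best) l'
  end.

Definition argmax_indexM I (l : seq (I * N)) : M (option I) :=
  if l is c :: l' then let* p := argmaxM c l' in op_ret O (Some p.1) else op_ret O None.

Variables (T L : nat) (Cbar Cund V Vbar : N) (x y : nat -> N) (zero : N).

Definition coefM (k s : nat) : M N :=
  let* kn := op_nat O k in let* sn := op_nat O s in let* d := op_sub O kn sn in
  let* dV := op_mul O d V in op_add O Cund dV.

Definition gainM (k t s : nat) : M (bool * N) :=
  let* c := coefM k s in let* c' := op_sub O c Vbar in
  let* d := op_sub O (y (t - s)%N) (y (t - s - 1)%N) in
  let* g := op_mul O c' d in let* pos := op_lt O zero g in op_ret O (pos, g).

Definition violM (k m t : nat) (Ysum Ssum : N) : M N :=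
  let* c := coefM k m in let* a := op_mul O c (y t) in
  let* b := op_mul O V Ysum in let* ab := op_add O a b in
  let* d := op_mul O Cund (y (t - k)%N) in let* rhs0 := op_sub O ab d in
  let* rhs := op_sub O rhs0 Ssum in let* lhs := op_sub O (x t) (x (t - k)%N) in
  op_sub O lhs rhs.

Definition feasibleM (k : nat) : M bool :=
  let* kn := op_nat O k in let* kV := op_mul O kn V in
  let* a := op_sub O Cbar Cund in let* b := op_sub O a kV in op_lt O zero b.

Definition candidatesM (t : nat) : M (seq (ineq_index * N)) :=
  let* Ys := psumsM zero [seq y (t + j)%N | j <- iota 1 T] in
  let* ks := filterM feasibleM [seq k <- iota 1 (T - 1) | (k < t)%N] in
  let* cs := mapM (fun k =>
    let* gs := mapM (gainM k t) (iota 0 k) in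
    let* Fs := psumsM zero [seq if g.1 then g.2 else zero | g <- gs] in
    mapM (fun m =>
      let n := minn k (L - m) in
      let* v := violM k m t (nth zero Ys m) (nth zero Fs n) in
      op_ret O ((k, m, [seq s <- iota 0 n | nth false (unzip1 gs) s], t) : ineq_index, v))
      [seq m <- iota 0 k | (t <= T - m)%N]) ks in
  op_ret O (flatten cs).

End Algorithm.

Definition alg1 : algorithm := fun M N O T L Cbar Cund V Vbar x y =>
  op_bind O (op_nat O 0) (fun zero =>
  op_bind O (mapM O (candidatesM O T L Cbar Cund V Vbar x y zero) (iota 1 T)) (fun cs =>
  argmax_indexM O (flatten cs))).

Definition reflect_index (T : nat) (i : ineq_index) : ineq_index :=
  let: (k, m, Ss, t) := i in (k, m, Ss, T.+1 - t)%N.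

Definition alg2 : algorithm := fun M N O T L Cbar Cund V Vbar x y =>
  op_bind O (alg1 O T L Cbar Cund V Vbar (fun u => x (T.+1 - u)%N) (fun u => y (T.+1 - u)%N))
    (fun r => op_ret O (omap (reflect_index T) r)).

Section CostSemantics.
Context {R : realFieldType}.
Local Notation O := (count_ops R).

Lemma bind_CM A B (m : CM A) (f : A -> CM B) :
  op_bind O m f = ((f m.1).1, (m.2 + (f m.1).2)%N).
Proof. by case: m => a c /=; case: (f a). Qed.

Lemma bind_CM1 A B (m : CM A) (f : A -> CM B) : (op_bind O m f).1 = (f m.1).1.
Proof. by rewrite bind_CM. Qed.

Lemma ret_CM1 A (a : A) : (op_ret O a).1 = a.
Proof. by []. Qed.

Lemma bind_cost_le A B (m : CM A) (f : A -> CM B) c1 c2 c :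
  (m.2 <= c1)%N -> ((f m.1).2 <= c2)%N -> (c1 + c2 <= c)%N -> ((op_bind O m f).2 <= c)%N.
Proof. by rewrite bind_CM => le_m le_f; apply: leq_trans (leq_add le_m le_f). Qed.

Lemma mapM_CM A B (f : A -> CM B) l :
  mapM O f l = ([seq (f a).1 | a <- l], sumn [seq (f a).2 | a <- l]).
Proof. by elim: l => //= a l ->; case: (f a) => b c /=; rewrite addn0. Qed.

Lemma mapM_val A B (f : A -> CM B) l : (mapM O f l).1 = [seq (f a).1 | a <- l].
Proof. by rewrite mapM_CM. Qed.

Lemma mapM_cost (A : eqType) B (f : A -> CM B) l c :
  {in l, forall a, (f a).2 <= c}%N -> ((mapM O f l).2 <= size l * c)%N.
Proof. by rewrite mapM_CM; apply: sumn_map_le. Qed.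

Lemma filterM_CM A (p : A -> CM bool) l :
  filterM O p l = ([seq a <- l | (p a).1], sumn [seq (p a).2 | a <- l]).
Proof.
rewrite /filterM bind_CM mapM_CM /= addn0; congr (_, _).
by elim: l => //= a l; case: (p a).1 => /= ->.
Qed.

Lemma filterM_val A (p : A -> CM bool) l : (filterM O p l).1 = [seq a <- l | (p a).1].
Proof. by rewrite filterM_CM. Qed.

Lemma psumsM_cost z l : (psumsM O z l).2 = size l.
Proof.
elim: l z => //= a l IH z.
by case E: (psumsM O (z + a) l) => [r c] /=; rewrite -(IH (z + a)) E /= addn0.
Qed.

Lemma nth_psumsM z l i :
  (i <= size l)%N -> nth 0 (psumsM O z l).1 i = z + \sum_(a <- take i l) a.
Proof.
elim: l z i => [|a l IH] z i /=; first by case: i => // _; rewrite big_nil addr0.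
have := IH (z + a); case: (psumsM O (z + a) l) => r c /= {}IH.
by case: i => [|i] lt_i /=; rewrite ?big_nil ?addr0 // IH // big_cons addrA.
Qed.

Lemma nth_psumsM_iota (f : nat -> R) a b n : (n <= b)%N ->
  nth 0 (psumsM O 0 [seq f i | i <- iota a b]).1 n = \sum_(a <= i < a + n) f i.
Proof.
move=> le_nb; rewrite nth_psumsM ?size_map ?size_iota // add0r -map_take take_iota.
by rewrite big_map /index_iota addKn (minn_idPl le_nb).
Qed.

Lemma argmaxM_CM (I : eqType) (best : I * R) l :
  let p := (argmaxM O best l).1 in
  [/\ (argmaxM O best l).2 = size l, p \in best :: l
    & {in best :: l, forall q, q.2 <= p.2}].
Proof.
elim: l best => [|c l IH] best /=.
  by split=> [||q]; rewrite ?mem_head // inE => /eqP ->.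
set b' := if _ then _ else _.
have := IH b'; case: (argmaxM O b' l) => p k /= [-> p_in p_max]; split => //.
- by move: p_in; rewrite !inE /b'; case: ifP => _ /orP [] ->; rewrite ?orbT.
- move=> q; rewrite !inE => /orP [/eqP ->|/orP [/eqP ->|q_in]].
  + apply: le_trans (p_max _ (mem_head _ _)); rewrite /b'.
    by case: ltP => // /ltW.
  + apply: le_trans (p_max _ (mem_head _ _)); rewrite /b'.
    by case: ltP.
  + by apply: p_max; rewrite inE q_in orbT.
Qed.

Lemma argmax_indexM_cost (I : eqType) (l : seq (I * R)) :
  ((argmax_indexM O l).2 <= size l)%N.
Proof.
case: l => //= c l; have [+ _ _] := argmaxM_CM c l.
by case: (argmaxM O c l) => p k /= ->; rewrite addn0.
Qed.

Lemma argmax_indexM_optimal (I : eqType) (P : pred I) (f : I -> R) (s : seq I) :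
  {in s, forall i, P i} -> (forall j, P j -> exists2 i, i \in s & f j <= f i) ->
  (exists j, P j) ->
  exists i, (argmax_indexM O [seq (i, f i) | i <- s]).1 = Some i /\ P i /\
            forall j, P j -> f j <= f i.
Proof.
move=> sP s_dom [j0 /s_dom [i0 i0_in _]].
case: s i0_in sP s_dom => // i s _ sP s_dom /=.
have [_] := argmaxM_CM (i, f i) [seq (i, f i) | i <- s].
case: (argmaxM _ _ _) => p c /=; rewrite -map_cons => /mapP [k k_in ->] p_max.
exists k; split=> //; split; rewrite ?sP // => j /s_dom [i' i'_in /le_trans]; apply.
by apply: (p_max (i', f i')); apply: map_f.
Qed.

End CostSemantics.

Arguments bind_cost_le {R A B m f} c1 c2 {c}.
Arguments mapM : simpl never.
Arguments filterM : simpl never.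
Arguments psumsM : simpl never.

Section FirstFamily.
Variables (R : realFieldType) (T L : nat) (Cbar Cund V Vbar : R) (x y : nat -> R).
Local Notation O := (count_ops R).
Local Notation valid := (valid1 T L Cbar Cund V Vbar).
Local Notation viol := (viol1 Cund V Vbar x y).
Local Notation candidatesM_R := (candidatesM O T L Cbar Cund V Vbar x y 0).

Definition gain (k t s : nat) : R :=
  (Cund + (k%:R - s%:R) * V - Vbar) * (y (t - s)%N - y (t - s - 1)%N).

Definition greedy_set (k m t : nat) : seq nat :=
  [seq s <- iota 0 (minn k (L - m)) | 0 < gain k t s].

Definition feasible_lengths (t : nat) : seq nat :=
  [seq k <- iota 1 (T - 1) | (k < t)%N && (0 < Cbar - Cund - k%:R * V)].

Definition candidates_at (t : nat) : seq ineq_index :=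
  [seq (k, m, greedy_set k m t, t) : ineq_index
  | k <- feasible_lengths t, m <- [seq m <- iota 0 k | (t <= T - m)%N]].

Definition candidates : seq ineq_index := flatten [seq candidates_at t | t <- iota 1 T].

Lemma viol1_split k m Ss t :
  viol (k, m, Ss, t) = viol (k, m, [::], t) + \sum_(s <- Ss) gain k t s.
Proof. by rewrite /viol1 big_nil; lra. Qed.

Lemma viol1_le_greedy k m Ss t :
  valid (k, m, Ss, t) -> viol (k, m, Ss, t) <= viol (k, m, greedy_set k m t, t).
Proof.
case/andP => /and5P [k_pos _ _ _ /andP [Ss_uniq Ss_range]] _.
rewrite [leLHS]viol1_split [leRHS]viol1_split lerD2l big_filter.
apply: sum_subset_le_sum_pos; rewrite ?iota_uniq // => s /(allP Ss_range).
by rewrite mem_iota; lia.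
Qed.

Lemma candidates_valid : {in candidates, forall i, valid i}.
Proof.
move=> i /flatten_mapP [t]; rewrite mem_iota => t_range.
case/allpairsPdep => k [m [+ + ->]].
rewrite !mem_filter !mem_iota => /and3P [/andP [k_t k_ok] k_lo k_hi] /andP [m_t m_lt].
apply/andP; split; last by lia.
rewrite /valid_kmS k_ok filter_uniq ?iota_uniq //=.
apply/and4P; split; try lia.
by apply/allP => s; rewrite mem_filter mem_iota => /andP [_]; lia.
Qed.

Lemma candidates_dominate j : valid j -> exists2 i, i \in candidates & viol j <= viol i.
Proof.
case: j => [[[k m] Ss] t] j_valid; have := j_valid.
case/andP => /and5P [k_lo k_hi k_ok m_lt _] /andP [t_lo t_hi].
exists (k, m, greedy_set k m t, t); last exact: viol1_le_greedy.
apply/flatten_mapP; exists t; first by rewrite mem_iota; lia.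
apply/allpairsPdep; exists k, m; rewrite !mem_filter !mem_iota k_ok.
by split=> //; apply/andP; split; lia.
Qed.

Lemma candidatesM_CM t : (candidatesM_R t).1 = [seq (i, viol i) | i <- candidates_at t].
Proof.
rewrite /candidatesM bind_CM1; cbv beta; rewrite bind_CM1; cbv beta; rewrite bind_CM1; cbv beta.
rewrite ret_CM1 mapM_val filterM_val -filter_predI map_flatten -map_comp; congr flatten.
rewrite (@eq_filter _ _ (fun k => (k < t)%N && (0 < Cbar - Cund - k%:R * V))); last first.
  by move=> k; rewrite /= andbC.
apply/eq_in_map => k; rewrite mem_filter mem_iota => /and3P [/andP [k_t _] _ _]; cbv beta.
rewrite bind_CM1; cbv beta; rewrite bind_CM1; cbv beta.
rewrite mapM_val [RHS]/comp -map_comp.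
apply/eq_in_map => m; rewrite mem_filter mem_iota => /and3P [m_t _ m_k]; cbv beta.
have le_n_k : (minn k (L - m) <= k)%N by rewrite geq_minl.
congr (_, _, _, _, _).
- rewrite /greedy_set mapM_val; apply: eq_in_filter => s; rewrite mem_iota => /andP [_ lt_s_n].
  rewrite /unzip1 -map_comp (nth_map 0%N) ?size_iota; last by lia.
  by rewrite nth_iota; [| lia].
- rewrite mapM_val -map_comp !nth_psumsM_iota ?size_map ?size_iota //; last by lia.
  rewrite /viol1 /greedy_set big_filter (big_mkcond (fun i => 0 < gain k t i)).
  by rewrite /index_iota add0n subn0.
Qed.

Lemma flatten_candidatesM :
  flatten (mapM O candidatesM_R (iota 1 T)).1 = [seq (i, viol i) | i <- candidates].
Proof.
rewrite mapM_val /candidates map_flatten -map_comp; congr flatten.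
by apply/eq_map => t /=; rewrite candidatesM_CM.
Qed.

Lemma alg1_value : (run alg1 T L Cbar Cund V Vbar x y).1 =
  (argmax_indexM O [seq (i, viol i) | i <- candidates]).1.
Proof.
rewrite /run /alg1 bind_CM1; cbv beta; rewrite bind_CM1; cbv beta.
by rewrite flatten_candidatesM.
Qed.

Section Cost.
Local Open Scope nat_scope.

Lemma candidatesM_cost t : (candidatesM_R t).2 <= 6 * T + 23 * T ^ 2.
Proof.
rewrite /candidatesM.
have size_ks : size [seq k <- iota 1 (T - 1) | k < t] <= T.
  by apply: leq_trans (size_filter_iota _ _ _) _; lia.
apply: (bind_cost_le T (5 * T + T * (23 * T))); last by lia.
  by rewrite psumsM_cost size_map size_iota.
apply: (bind_cost_le (5 * T) (T * (23 * T))) => //.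
  rewrite filterM_CM mulnC; apply: leq_trans (sumn_map_le (c := 5) _) _ => //.
  by rewrite leq_mul2r size_ks orbT.
apply: (bind_cost_le (T * (23 * T)) 0) => //; last by rewrite addn0.
rewrite filterM_val; apply: leq_trans (mapM_cost (c := 23 * T) _) _; last first.
  by rewrite leq_mul2r size_filter (leq_trans (count_size _ _) size_ks) orbT.
move=> k; rewrite !mem_filter mem_iota => /and3P [_ _ /andP [_ k_lt]].
apply: (bind_cost_le (9 * k) (k + 13 * k)); last by lia.
  by apply: leq_trans (mapM_cost (c := 9) _) _ => //; rewrite size_iota mulnC.
apply: (bind_cost_le k (13 * k)) => //.
  by rewrite psumsM_cost size_map mapM_val size_map size_iota.
rewrite mulnC; apply: leq_trans (mapM_cost (c := 13) _) _.
  by move=> m _; rewrite bind_CM.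
by rewrite leq_mul2r size_filter_iota orbT.
Qed.

Lemma size_candidates : size candidates <= T ^ 3.
Proof.
rewrite /candidates size_flatten /shape -map_comp.
apply: leq_trans (sumn_map_le (c := T * T) _) _; last first.
  by rewrite size_iota !expnS expn0 muln1.
move=> t _ /=; rewrite /candidates_at size_allpairs_dep.
apply: leq_trans (sumn_map_le (c := T) _) _.
  move=> k; rewrite mem_filter mem_iota => /andP [_ /andP [_ k_lt]].
  by apply: leq_trans (size_filter_iota _ _ _) _; lia.
by rewrite leq_mul2r (leq_trans (size_filter_iota _ _ _)) ?orbT //; lia.
Qed.

Lemma alg1_cost : 0 < T -> (run alg1 T L Cbar Cund V Vbar x y).2 <= 31 * T ^ 3.
Proof.
move=> T_pos; rewrite /run /alg1.
apply: (bind_cost_le 1 (T * (6 * T + 23 * T ^ 2) + T ^ 3)) => //; last by nia.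
apply: (bind_cost_le (T * (6 * T + 23 * T ^ 2)) (T ^ 3)) => //.
  apply: leq_trans (mapM_cost (c := 6 * T + 23 * T ^ 2) _) _; last by rewrite size_iota.
  by move=> t _; apply: candidatesM_cost.
apply: leq_trans (argmax_indexM_cost _) _.
by rewrite flatten_candidatesM size_map size_candidates.
Qed.

End Cost.
End FirstFamily.

Lemma alg1_separates : separates_in_cubic_time alg1 (@valid1) (@viol1).
Proof.
exists 31%N => R T L Cbar Cund V Vbar x y [[T_pos _ _ _ _] _] _; split.
  exact: alg1_cost.
case=> j /andP [j_valid _]; rewrite alg1_value.
apply: argmax_indexM_optimal; last by exists j.
  exact: candidates_valid.
exact: candidates_dominate.
Qed.

Section Reflection.
Context {R : realFieldType} {T L : nat} {Cbar Cund V Vbar : R} (x y : nat -> R).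
Local Notation valid1 := (valid1 T L Cbar Cund V Vbar).
Local Notation valid2 := (valid2 T L Cbar Cund V Vbar).

Lemma reflect_indexK i : (i.2 <= T)%N -> reflect_index T (reflect_index T i) = i.
Proof. by case: i => [[[k m] Ss] t] /= t_le; congr (_, _, _, _); lia. Qed.

Lemma valid2_reflect i : valid2 i = valid1 (reflect_index T i).
Proof.
case: i => [[[k m] Ss] t] /=; case kmS: (valid_kmS _ _ _ _ _ _ _ _ _) => //=.
move: kmS => /and5P [k_pos k_lt _ m_lt _].
by apply/idP/idP => /andP [t_lo t_hi]; apply/andP; split; lia.
Qed.

Lemma viol2_reflect i : valid2 i ->
  viol2 Cund V Vbar x y i =
  viol1 Cund V Vbar (fun u => x (T.+1 - u)%N) (fun u => y (T.+1 - u)%N) (reflect_index T i).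
Proof.
case: i => [[[k m] Ss] t] /andP [/and5P [k_pos k_lt _ m_lt /andP [_ Ss_range]] /andP [t_lo t_hi]].
rewrite /viol1 /viol2 /=.
have -> : (T.+1 - (T.+1 - t) = t)%N by lia.
have -> : (T.+1 - (T.+1 - t - k) = t + k)%N by lia.
congr (_ - (_ + _ * _ - _ - _)).
  by apply: eq_big_nat => j j_range; congr y; lia.
apply: eq_big_seq => s /(allP Ss_range) s_range.
by congr (_ * (y _ - y _)); lia.
Qed.

End Reflection.

Lemma alg2_separates : separates_in_cubic_time alg2 (@valid2) (@viol2).
Proof.
have [c alg1_ok] := alg1_separates.
exists c => R T L Cbar Cund V Vbar x y params nonneg.
set x' := fun u => x (T.+1 - u)%N; set y' := fun u => y (T.+1 - u)%N.
have nonneg' i : (1 <= i <= T)%N -> 0 <= x' i /\ 0 <= y' i.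
  by move=> i_range; apply: nonneg; lia.
have [cost1 opt1] := alg1_ok R T L Cbar Cund V Vbar x' y' params nonneg'.
rewrite /run /alg2 bind_CM /= addn0; split=> // -[j /andP [j_valid j_viol]].
have [|i [-> [i_valid i_max]]] := opt1.
  by exists (reflect_index T j); rewrite -valid2_reflect j_valid -(viol2_reflect x y j_valid).
have i_le : (i.2 <= T)%N.
  by move: i_valid; case: i {i_max} => [[[k m] Ss] t] /andP [_ /andP [_ t_hi]] /=; lia.
have valid_i : valid2 T L Cbar Cund V Vbar (reflect_index T i).
  by rewrite valid2_reflect reflect_indexK.
exists (reflect_index T i); split=> //; split=> // j' j'_valid.
rewrite (viol2_reflect x y j'_valid) (viol2_reflect x y valid_i) reflect_indexK //.
by apply: i_max; rewrite -valid2_reflect.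
Qed.

Theorem proposition10 :
  (exists alg : algorithm,
     separates_in_cubic_time alg (@valid1) (@viol1)) /\
  (exists alg : algorithm,
     separates_in_cubic_time alg (@valid2) (@viol2)).
Proof.
split; [exists alg1; exact: alg1_separates | exists alg2; exact: alg2_separates].
Qed.
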